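(* Let $A$ be a countable discrete alphabet, let $X\subseteq A^{\mathbb N}$ be a one-sided shift space with the left shift $\sigma:X\to X$, and let $d$ be any prefix ultrametric on $X$ (for instance the standard product ultrametric $d_{\mathrm{prod}}$). Then $(X,\sigma,d)$ has the shadowing property if and only if it has the Lipschitz shadowing property. Moreover, if shadowing holds, then Lipschitz shadowing holds with Lipschitz constant $L=1$.
   Context: Sequences in $A^{\mathbb N}$ are indexed as $x=x_0x_1x_2\cdots$, and $\sigma(x)_i=x_{i+1}$. A one-sided shift space is a subset $X\subseteq A^{\mathbb N}$ that is closed in the product topology ($A$ discrete) and satisfies $\sigma(X)\subseteq X$. For $x\neq y$ put $N(x,y):=\min\{n\ge0:\ x_n\ne y_n\}$. A metric $d$ on $X$ is a prefix ultrametric if there exists a strictly decreasing sequence $(r_n)_{n\ge0}\subset(0,\infty)$ with $r_n\downarrow 0$ such that $d(x,y)=r_{N(x,y)}$ for $x\ne y$, and $d(x,x)=0$. The standard product ultrametric is $d_{\mathrm{prod}}(x,y)=2^{-N(x,y)}$ for $x\neq y$ (and $0$ for $x=y$). For $\delta>0$, a sequence $(x^n)_{n\ge0}$ in $X$ is a $\delta$-pseudo-orbit if $d(\sigma(x^n),x^{n+1})<\delta$ for all $n\ge0$. A point $x\in X$ $\varepsilon$-shadows $(x^n)_{n\ge0}$ if $d(\sigma^i(x),x^i)<\varepsilon$ for all $i\ge0$. $(X,\sigma,d)$ has the shadowing property if for every $\varepsilon>0$ there exists $\delta>0$ such that every $\delta$-pseudo-orbit is $\varepsilon$-shadowed by some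 point of $X$. It has the Lipschitz shadowing property if there exist $L>0$ and $\delta_0>0$ such that for every $\delta\in(0,\delta_0]$, every $\delta$-pseudo-orbit is $L\delta$-shadowed by some point of $X$; such an $L$ is called a Lipschitz constant. *)

(* Defs.v *)
From HB Require Import structures.
From mathcomp Require Import all_boot all_order all_algebra.
From mathcomp Require Import all_classical all_reals.
From mathcomp Require Import topology normedtype sequences.
Set Implicit Arguments.
Unset Strict Implicit.
Unset Printing Implicit Defensive.
Import Order.TTheory GRing.Theory Num.Theory numFieldNormedType.Exports.
Local Open Scope classical_set_scope.
Local Open Scope ring_scope.

Definition shift (A : Type) (x : nat -> A) : nat -> A := fun i => x i.+1.

Record one_sided_shift_space (A : countType) (X : set (nat -> A)) : Prop := {
  shift_space_closed : closed (X : set {ptws nat -> discrete_topology A}) ;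
  shift_space_stable : @shift A @` X `<=` X }.

Definition shift_on (A : countType) (X : set (nat -> A))
    (hX : one_sided_shift_space X) (x : X) : X :=
  SigSub (mem_set (shift_space_stable hX (imageP (@shift A) (set_valP x)))).

(* The value 0 for x = y is junk: it is only used for x <> y. *)
Definition first_diff (A : eqType) (x y : nat -> A) : nat :=
  if pselect (exists n, x n != y n) is left h then ex_minn h else 0%N.

Definition is_metric (R : realType) (S : Type) (d : S -> S -> R) : Prop :=
  [/\ forall x y, 0 <= d x y,
      forall x y, d x y = 0 <-> x = y,
      forall x y, d x y = d y x
    & forall x y z, d x z <= d x y + d y z].

Definition prefix_ultrametric (R : realType) (A : countType)
    (X : set (nat -> A)) (d : X -> X -> R) : Prop :=
  is_metric d /\
  exists r : nat -> R,
    [/\ forall n, 0 < r n, decreasing_seq r, r @ \oo --> (0 : R),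
        forall x y : X, x <> y -> d x y = r (first_diff (val x) (val y))
      & forall x : X, d x x = 0].

Definition prod_dist (R : realType) (A : countType) (X : set (nat -> A))
    (x y : X) : R :=
  if x == y then 0 else 2 ^- first_diff (val x) (val y).

Definition pseudo_orbit (R : realType) (S : Type) (f : S -> S)
    (d : S -> S -> R) (delta : R) (xs : nat -> S) : Prop :=
  forall n, d (f (xs n)) (xs n.+1) < delta.

Definition shadows (R : realType) (S : Type) (f : S -> S)
    (d : S -> S -> R) (eps : R) (x : S) (xs : nat -> S) : Prop :=
  forall i, d (iter i f x) (xs i) < eps.

Definition shadowing_property (R : realType) (S : Type) (f : S -> S)
    (d : S -> S -> R) : Prop :=
  forall eps : R, 0 < eps -> exists delta : R, 0 < delta /\
    forall xs : nat -> S, pseudo_orbit f d delta xs ->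
      exists x : S, shadows f d eps x xs.

Definition lipschitz_shadowing_constant (R : realType) (S : Type) (f : S -> S)
    (d : S -> S -> R) (L : R) : Prop :=
  0 < L /\ exists delta0 : R, 0 < delta0 /\
    forall delta : R, 0 < delta -> delta <= delta0 ->
      forall xs : nat -> S, pseudo_orbit f d delta xs ->
        exists x : S, shadows f d (L * delta) x xs.

Definition lipschitz_shadowing_property (R : realType) (S : Type) (f : S -> S)
    (d : S -> S -> R) : Prop :=
  exists L : R, lipschitz_shadowing_constant f d L.

Lemma first_diff_neq (A : eqType) (x y : nat -> A) :
  x <> y -> x (first_diff x y) != y (first_diff x y).
Proof.
move=> xy; rewrite /first_diff; case: pselect => [h|h]; first by case: ex_minnP.
by exfalso; apply: xy; apply/funext => n; apply/eqP/negPn/negP => hn;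
  apply: h; exists n.
Qed.

Lemma first_diff_min (A : eqType) (x y : nat -> A) n :
  x n != y n -> (first_diff x y <= n)%N.
Proof.
move=> hn; rewrite /first_diff; case: pselect => [h|//].
by case: ex_minnP => m _; apply.
Qed.

Lemma first_diff_sym (A : eqType) (x y : nat -> A) :
  first_diff x y = first_diff y x.
Proof.
have [->//|xy] := pselect (x = y); apply/eqP; rewrite eqn_leq.
by apply/andP; split; apply: first_diff_min; rewrite eq_sym;
  apply: first_diff_neq => // /esym.
Qed.

(* The formula defining a prefix ultrametric makes the metric axioms automatic. *)
Lemma prefix_ultrametricI (R : realType) (A : countType) (X : set (nat -> A))
    (d : X -> X -> R) (r : nat -> R) :
  (forall n, 0 < r n) -> decreasing_seq r -> r @ \oo --> (0 : R) ->
  (forall x y : X, x <> y -> d x y = r (first_diff (val x) (val y))) ->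
  (forall x : X, d x x = 0) -> prefix_ultrametric d.
Proof.
move=> r0 rd rl dr d0; split; last by exists r.
have ge0 x y : 0 <= d x y.
  by have [->|xy] := pselect (x = y); rewrite ?d0// dr// ltW.
have vneq (x y : X) : x <> y -> val x <> val y by move=> xy /val_inj.
split=> //.
- move=> x y; split=> [|->//]; have [//|xy] := pselect (x = y).
  by rewrite dr// => e; have := r0 (first_diff (val x) (val y)); rewrite e ltxx.
- move=> x y; have [->//|xy] := pselect (x = y).
  by rewrite !dr//; [congr (r _); exact: first_diff_sym | move=> /esym].
- move=> x y z; have [->|xy] := pselect (x = y); first by rewrite d0 add0r.
  have [->|yz] := pselect (y = z); first by rewrite d0 addr0.
  have [->|xz] := pselect (x = z); first by rewrite d0 addr_ge0.
  have := first_diff_neq (vneq _ _ xz).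
  rewrite (dr _ _ xz); set n := first_diff _ _ => hn.
  have [e|hxy] := eqVneq (val x n) (val y n).
    rewrite e in hn; apply: (le_trans _ (_ : d y z <= _)); last by rewrite lerDr.
    by rewrite dr// rd first_diff_min.
  apply: (le_trans _ (_ : d x y <= _)); last by rewrite lerDl.
  by rewrite dr// rd first_diff_min.
Qed.

Lemma prod_dist_prefix_ultrametric (R : realType) (A : countType)
    (X : set (nat -> A)) : prefix_ultrametric (@prod_dist R A X).
Proof.
apply: (@prefix_ultrametricI _ _ _ _ (fun n => 2 ^- n)).
- by move=> n; rewrite invr_gt0 exprn_gt0.
- by move=> m n; rewrite lef_pV2 ?posrE ?exprn_gt0// ler_eXn2l ?ltr1n.
- have -> : (fun n => 2 ^- n : R) = (fun n => 2^-1 ^+ n) by apply/funext => n; rewrite exprVn.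
  by apply: cvg_expr; rewrite ger0_norm ?invr_ge0// invf_lt1 ?ltr1n.
- by move=> x y /eqP /negPf xy; rewrite /prod_dist xy.
- by move=> x; rewrite /prod_dist eqxx.
Qed.

(* Main.v *)
Require Import Defs.
From mathcomp Require Import all_boot all_order all_algebra.
From mathcomp Require Import all_classical all_reals.
Local Open Scope ring_scope.

(** The distances strictly decrease with the length of the common prefix, so
    being closer than [r n] means agreeing at all indices up to [n]
    ([lt_radius_agree]).  A pseudo-orbit whose jumps are smaller than [r n]
    therefore has its symbols dictated by the initial ones: sliding along the
    pseudo-orbit while shifting back gives [x^i_j = x^{i+j}_0] for [j <= n.+1]
    ([pseudo_orbit_symbol]).

    Shadowing at the single scale [eps = r 0] provides a threshold [delta0]
    below which every pseudo-orbit is followed in its initial symbols by some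
    point [x], that is [x_i = x^i_0] for all [i].  This same [x] already shadows
    to the precision of the pseudo-orbit ([shadows_self]): if [sigma^i x] and
    [x^i] first differ at index [N] with [delta <= r N], then the jumps are
    smaller than [r N], whence [x^i_N = x^{i+N}_0 = x_{i+N} = (sigma^i x)_N], a
    contradiction.  So [r N < delta], which is Lipschitz shadowing with
    constant 1.  The converse holds for any self-map: shrink [delta] so that
    [L * delta <= eps]. *)

Set Implicit Arguments.
Unset Strict Implicit.
Unset Printing Implicit Defensive.
Import Order.TTheory GRing.Theory Num.Theory.

Lemma lipschitz_shadowing_constant_shadowing (R : realType) (S : Type)
    (f : S -> S) (d : S -> S -> R) (L : R) :
  lipschitz_shadowing_constant f d L -> shadowing_property f d.
Proof.
move=> [L0 [delta0 [delta0_gt0 lip]]] eps eps0.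
have delta_gt0 : 0 < Num.min delta0 (eps / L) by rewrite lt_min delta0_gt0 divr_gt0.
exists (Num.min delta0 (eps / L)); split=> // xs xsP.
have [|x xP] := lip _ delta_gt0 _ xs xsP; first by rewrite ge_min lexx.
exists x => i; apply: (lt_le_trans (xP i)).
by rewrite mulrC -ler_pdivlMr// ge_min lexx orbT.
Qed.

Section PrefixUltrametric.
Variables (R : realType) (A : countType) (X : set (nat -> A)).
Variables (hX : one_sided_shift_space X) (d : X -> X -> R) (r : nat -> R).
Hypothesis r_decr : forall m n, (r m <= r n) = (n <= m)%N.
Hypothesis d_first_diff :
  forall x y : X, x <> y -> d x y = r (Defs.first_diff (val x) (val y)).

Lemma val_iter_shift_on (x : X) i n :
  val (iter i (shift_on hX) x) n = val x (i + n)%N.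
Proof. by elim: i n => [//|i IH] n; rewrite iterS /= /shift IH addnS. Qed.

Lemma lt_radius_agree (x y : X) n k :
  d x y < r n -> (k <= n)%N -> val x k = val y k.
Proof.
have [->//|xy] := pselect (x = y).
rewrite d_first_diff// => lt_rn kn; apply/eqP; apply: contraLR lt_rn.
by move=> /first_diff_min Nk; rewrite -leNgt r_decr; exact: leq_trans kn.
Qed.

(** Each step of the pseudo-orbit trades one index of the symbol for one unit
    of time, so symbol [j] at time [i] is the initial symbol at time [i + j]. *)
Lemma pseudo_orbit_symbol (xs : nat -> X) n i j :
  pseudo_orbit (shift_on hX) d (r n) xs -> (j <= n.+1)%N ->
  val (xs i) j = val (xs (i + j)%N) 0%N.
Proof.
move=> xsP; elim: j i => [|j IH] i jn; first by rewrite addn0.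
rewrite addnS -addSn -(IH _ (ltnW jn)).
exact: (lt_radius_agree (xsP i) jn).
Qed.

(** Following the initial symbols is enough to shadow with precision equal to
    the size of the jumps; this is where the constant 1 comes from. *)
Lemma shadows_self (xs : nat -> X) (delta : R) (x : X) :
  0 < delta -> (forall y, d y y = 0) ->
  pseudo_orbit (shift_on hX) d delta xs ->
  (forall i, val x i = val (xs i) 0%N) ->
  shadows (shift_on hX) d delta x xs.
Proof.
move=> delta0 d0 xsP x0 i.
have [->|neq] := pselect (iter i (shift_on hX) x = xs i); first by rewrite d0.
rewrite d_first_diff//.
have vneq : val (iter i (shift_on hX) x) <> val (xs i) by move=> /val_inj.
have := first_diff_neq vneq; set N := Defs.first_diff _ _.
apply: contraNT; rewrite -leNgt => le_rN.
have xsN : pseudo_orbit (shift_on hX) d (r N) xs.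
  by move=> m; exact: lt_le_trans (xsP m) le_rN.
by rewrite val_iter_shift_on x0 (pseudo_orbit_symbol i xsN (leqnSn N)).
Qed.

End PrefixUltrametric.

Theorem corollary3p5 (R : realType) (A : countType) (X : set (nat -> A))
    (hX : one_sided_shift_space X) (d : X -> X -> R)
    (hd : prefix_ultrametric d) :
  (shadowing_property (shift_on hX) d <->
     lipschitz_shadowing_property (shift_on hX) d) /\
  (shadowing_property (shift_on hX) d ->
     lipschitz_shadowing_constant (shift_on hX) d 1).
Proof.
have lip1 : shadowing_property (shift_on hX) d ->
    lipschitz_shadowing_constant (shift_on hX) d 1.
  case: hd => _ [r [r0 decr_r _ dr d0]] sh; split; first exact: ltr01.
  have r_decr m n : (r m <= r n) = (n <= m)%N by exact: decr_r.
  have [delta0 [delta0_gt0 sh0]] := sh _ (r0 0%N).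
  exists delta0; split=> // delta delta_gt0 le_delta xs xsP.
  have [|x xP] := sh0 xs; first by move=> n; exact: lt_le_trans (xsP n) le_delta.
  exists x; rewrite mul1r.
  apply: (shadows_self r_decr dr) => // i.
  by rewrite -(lt_radius_agree r_decr dr (xP i) (leqnn 0)) val_iter_shift_on addn0.
split=> //; split=> [/lip1 h|[L]]; first by exists 1.
exact: lipschitz_shadowing_constant_shadowing.
Qed.
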